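(* Let $\Bbbk$ be a field and let $F\colon\mathcal{C}\to\mathcal{D}$ be a $\Bbbk$-linear monoidal functor between $\Bbbk$-linear additive rigid monoidal categories. Suppose that (1) the functor $\mathcal{D}(F(-),\mathbf 1)$ is representable by an object $Z\in\mathcal{C}$, (2) $F$ is dominant, and (3) $\mathcal{C}$ is idempotent complete. Then $F$ has both a left adjoint $L$ and a right adjoint $R$ such that $R(\mathbf 1)\cong Z$ and $L(\mathbf 1)\cong Z^*\cong{}^*Z$.
   Context: A monoidal category is rigid if every object $X$ has a left dual $X^*$ (with coevaluation $\mathbf 1\to X\otimes X^*$ and evaluation $X^*\otimes X\to\mathbf 1$) and a right dual ${}^*X$ (an object of which $X$ is a left dual). A linear functor $F\colon\mathcal{C}\to\mathcal{D}$ between $\Bbbk$-linear categories is dominant if for every $Y\in\mathcal{D}$ there exists $X\in\mathcal{C}$ such that $Y$ is a direct summand of $F(X)$. $\mathbf 1$ denotes the tensor unit. *)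

(* Defs.v *)
From HB Require Import structures.
From mathcomp Require Import all_boot all_algebra.

Set Implicit Arguments.
Unset Strict Implicit.
Unset Printing Implicit Defensive.

Import GRing.Theory.

Local Open Scope ring_scope.

Declare Scope cat_scope.
Delimit Scope cat_scope with cat.

Record linearCategory (k : fieldType) := LinearCategory {
  obj :> Type;
  hom : obj -> obj -> lmodType k;
  idm : forall X, hom X X;
  comp : forall X Y Z, hom Y Z -> hom X Y -> hom X Z;
  comp1m : forall X Y (f : hom X Y), comp (idm Y) f = f;
  compm1 : forall X Y (f : hom X Y), comp f (idm X) = f;
  compA : forall X Y Z W (h : hom Z W) (g : hom Y Z) (f : hom X Y),
    comp h (comp g f) = comp (comp h g) f;
  comp_linearl : forall X Y Z (f : hom X Y),
    linear (fun g : hom Y Z => comp g f);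
  comp_linearr : forall X Y Z (g : hom Y Z),
    linear (fun f : hom X Y => comp g f)
}.

Arguments hom {k l} X Y.
Arguments idm {k l} X.
Arguments comp {k l X Y Z} g f.

Notation "g \o f" := (comp g f) : cat_scope.
Local Open Scope cat_scope.

Section LinearCategories.
Variable k : fieldType.

Record iso (C : linearCategory k) (X Y : C) := Iso {
  fwd : hom X Y;
  bwd : hom Y X;
  bwdK : bwd \o fwd = idm X;
  fwdK : fwd \o bwd = idm Y
}.

Definition isomorphic (C : linearCategory k) (X Y : C) : Prop :=
  inhabited (iso X Y).

Definition is_zero_object (C : linearCategory k) (O : C) : Prop :=
  forall X : C, (forall f : hom O X, f = 0) /\ (forall f : hom X O, f = 0).

Definition is_biproduct (C : linearCategory k) (X Y B : C) : Prop :=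
  exists (i1 : hom X B) (i2 : hom Y B) (p1 : hom B X) (p2 : hom B Y),
    [/\ p1 \o i1 = idm X, p2 \o i2 = idm Y,
        p2 \o i1 = 0, p1 \o i2 = 0
      & (i1 \o p1) + (i2 \o p2) = idm B].

Definition additive_category (C : linearCategory k) : Prop :=
  (exists O : C, is_zero_object O) /\
  (forall X Y : C, exists B : C, is_biproduct X Y B).

Definition idempotent_complete (C : linearCategory k) : Prop :=
  forall (X : C) (e : hom X X), e \o e = e ->
  exists (Y : C) (r : hom X Y) (s : hom Y X), r \o s = idm Y /\ s \o r = e.

(* A direct summand has a complement; without idempotent completeness this  *)
(* is more than being a retract.                                            *)
Definition direct_summand (C : linearCategory k) (Y X : C) : Prop :=
  exists Y' : C, is_biproduct Y Y' X.

Record functor (C D : linearCategory k) := Functor {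
  fobj :> C -> D;
  fmap : forall X Y : C, hom X Y -> hom (fobj X) (fobj Y);
  fmap_id : forall X, fmap (idm X) = idm (fobj X);
  fmap_comp : forall X Y Z (g : hom Y Z) (f : hom X Y),
    fmap (g \o f) = fmap g \o fmap f
}.

Definition linear_functor (C D : linearCategory k) (F : functor C D) : Prop :=
  forall X Y : C, linear (@fmap C D F X Y).

Definition dominant (C D : linearCategory k) (F : functor C D) : Prop :=
  forall Y : D, exists X : C, direct_summand Y (F X).

(* The presheaf D(F(-), W) on C is naturally isomorphic to C(-, Z).  By the *)
(* Yoneda lemma the bijections are k-linear when F is.                      *)
Definition represents_hom_into (C D : linearCategory k) (F : functor C D)
    (W : D) (Z : C) : Prop :=
  exists phi : forall X : C, hom X Z -> hom (F X) W,
    (forall X, bijective (phi X)) /\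
    (forall (X X' : C) (f : hom X' X) (g : hom X Z),
       phi X' (g \o f) = phi X g \o fmap F f).

(* G is left adjoint to H.                                                  *)
Definition adjoint (C D : linearCategory k) (G : functor C D)
    (H : functor D C) : Prop :=
  exists phi : forall (X : C) (Y : D), hom (G X) Y -> hom X (H Y),
    (forall X Y, bijective (phi X Y)) /\
    (forall (X X' : C) (Y Y' : D) (f : hom X' X) (g : hom Y Y')
       (h : hom (G X) Y),
       phi X' Y' (g \o h \o fmap G f) = fmap H g \o phi X Y h \o f).

End LinearCategories.

Arguments fmap {k C D} F {X Y} f : rename.

(* k-linear monoidal category: the tensor product is k-bilinear on          *)
(* morphisms.                                                               *)
Record monoidalCategory (k : fieldType) := MonoidalCategory {
  mcat :> linearCategory k;
  tens : mcat -> mcat -> mcat;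
  tensm : forall X X' Y Y' : mcat,
    hom X X' -> hom Y Y' -> hom (tens X Y) (tens X' Y');
  tunit : mcat;
  tensm_id : forall X Y, tensm (idm X) (idm Y) = idm (tens X Y);
  tensm_comp : forall X X' X'' Y Y' Y'' (f' : hom X' X'') (f : hom X X')
      (g' : hom Y' Y'') (g : hom Y Y'),
    tensm (f' \o f) (g' \o g) = tensm f' g' \o tensm f g;
  tensm_linearl : forall X X' Y Y' (g : hom Y Y'),
    linear (fun f : hom X X' => tensm f g);
  tensm_linearr : forall X X' Y Y' (f : hom X X'),
    linear (fun g : hom Y Y' => tensm f g);
  assoc : forall X Y Z, iso (tens (tens X Y) Z) (tens X (tens Y Z));
  lunit : forall X, iso (tens tunit X) X;
  runit : forall X, iso (tens X tunit) X;
  assoc_nat : forall X X' Y Y' Z Z'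
      (f : hom X X') (g : hom Y Y') (h : hom Z Z'),
    fwd (assoc X' Y' Z') \o tensm (tensm f g) h
    = tensm f (tensm g h) \o fwd (assoc X Y Z);
  lunit_nat : forall X X' (f : hom X X'),
    fwd (lunit X') \o tensm (idm tunit) f = f \o fwd (lunit X);
  runit_nat : forall X X' (f : hom X X'),
    fwd (runit X') \o tensm f (idm tunit) = f \o fwd (runit X);
  pentagon : forall X Y Z W,
    fwd (assoc X Y (tens Z W)) \o fwd (assoc (tens X Y) Z W)
    = tensm (idm X) (fwd (assoc Y Z W))
      \o fwd (assoc X (tens Y Z) W)
      \o tensm (fwd (assoc X Y Z)) (idm W);
  triangle : forall X Y,
    tensm (idm X) (fwd (lunit Y)) \o fwd (assoc X tunit Y)
    = tensm (fwd (runit X)) (idm Y)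
}.

Arguments tens {k m} X Y.
Arguments tensm {k m X X' Y Y'} f g.
Arguments tunit {k m}.
Arguments assoc {k m} X Y Z.
Arguments lunit {k m} X.
Arguments runit {k m} X.

Notation "X \ox Y" := (tens X Y) (at level 40, left associativity) : cat_scope.
Notation "f \oxm g" := (tensm f g)
  (at level 40, left associativity) : cat_scope.

Section MonoidalCategories.
Variable k : fieldType.

Definition is_left_dual (C : monoidalCategory k) (X Xd : C) : Prop :=
  exists (coev : hom tunit (X \ox Xd)) (ev : hom (Xd \ox X) tunit),
    fwd (runit X) \o (idm X \oxm ev) \o fwd (assoc X Xd X)
      \o (coev \oxm idm X) \o bwd (lunit X) = idm X /\
    fwd (lunit Xd) \o (ev \oxm idm Xd) \o bwd (assoc Xd X Xd)
      \o (idm Xd \oxm coev) \o bwd (runit Xd) = idm Xd.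

Definition is_right_dual (C : monoidalCategory k) (X dX : C) : Prop :=
  is_left_dual dX X.

Definition rigid (C : monoidalCategory k) : Prop :=
  forall X : C, (exists Xd : C, is_left_dual X Xd) /\
                (exists dX : C, is_right_dual X dX).

(* Monoidal functors are strong.                                            *)
Record monoidalStructure (C D : monoidalCategory k) (F : functor C D) :=
  MonoidalStructure {
  mu : forall X Y : C, iso (F X \ox F Y) (F (X \ox Y));
  eta : iso tunit (F tunit);
  mu_nat : forall (X X' Y Y' : C) (f : hom X X') (g : hom Y Y'),
    fwd (mu X' Y') \o (fmap F f \oxm fmap F g)
    = fmap F (f \oxm g) \o fwd (mu X Y);
  mu_assoc : forall X Y Z : C,
    fmap F (fwd (assoc X Y Z)) \o fwd (mu (X \ox Y) Z)
      \o (fwd (mu X Y) \oxm idm (F Z))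
    = fwd (mu X (Y \ox Z)) \o (idm (F X) \oxm fwd (mu Y Z))
      \o fwd (assoc (F X) (F Y) (F Z));
  mu_lunit : forall X : C,
    fmap F (fwd (lunit X)) \o fwd (mu tunit X) \o (fwd eta \oxm idm (F X))
    = fwd (lunit (F X));
  mu_runit : forall X : C,
    fmap F (fwd (runit X)) \o fwd (mu X tunit) \o (idm (F X) \oxm fwd eta)
    = fwd (runit (F X))
}.

End MonoidalCategories.

(* Main.v *)
(* Let u : F Z -> 1 be the universal arrow. For A, X in C the map
   C(A, Z (x) X) -> D(F A, F X), h |-> lunit o (u (x) F X) o mu^-1 o F h, is
   natural in A and X. With X the left dual of V it is the composite of
   C(A, Z (x) X) = C(A (x) V, Z) = D(F (A (x) V), 1) = D(F A (x) F V, 1)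
   = D(F A, F X), hence bijective; so Z (x) X represents D(F -, F X). Since
   Z^* (x) - is left adjoint to Z (x) -, the object Z^* (x) X corepresents
   D(F X, F -). As F is dominant and idempotents split in C, all D(F -, W) and
   D(W, F -) are then (co)representable, which gives R and L. The case X = 1
   gives L 1 = Z^*, and the same argument for the reversed tensor products
   gives L 1 = *Z. *)
Require Import Defs.
From HB Require Import structures.
From mathcomp Require Import all_boot all_algebra.
From Stdlib Require Import IndefiniteDescription.
(* Again, because [vector] also exports a [hom]. *)
Import Defs.

Set Implicit Arguments.
Unset Strict Implicit.
Unset Printing Implicit Defensive.

Local Open Scope cat_scope.

(** * Composition and isomorphisms in a linear category *)

Section LinearCategories.
Variable k : fieldType.
Implicit Types C D : linearCategory k.

(** Composites are kept associated to the right. This form lets an equation rewrite two adjacent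
    factors in front of a tail [x]. *)
Lemma precomp C (X Y Z W : C) (g : hom Y Z) (f : hom X Y) (h : hom X Z)
    (x : hom W X) :
  g \o f = h -> g \o (f \o x) = h \o x.
Proof. by move=> <-; rewrite compA. Qed.

Lemma bwdKl C (X Y W : C) (i : iso X Y) (x : hom W X) :
  bwd i \o (fwd i \o x) = x.
Proof. by rewrite (precomp _ (bwdK i)) comp1m. Qed.

Lemma fwdKl C (X Y W : C) (i : iso X Y) (x : hom W Y) :
  fwd i \o (bwd i \o x) = x.
Proof. by rewrite (precomp _ (fwdK i)) comp1m. Qed.

Lemma iso_monol C (X Y W : C) (i : iso X Y) (f g : hom W X) :
  fwd i \o f = fwd i \o g -> f = g.
Proof. by move=> e; rewrite -(bwdKl i f) e bwdKl. Qed.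

Lemma iso_square C (X X' Y Y' : C) (i : iso X Y) (i' : iso X' Y')
    (f : hom X X') (g : hom Y Y') :
  fwd i' \o f = g \o fwd i -> bwd i' \o g = f \o bwd i.
Proof.
move=> e; apply: (iso_monol (i := i')).
by rewrite fwdKl compA e -compA fwdK compm1.
Qed.

Lemma bwd_unique C (X Y : C) (i j : iso X Y) : fwd i = fwd j -> bwd i = bwd j.
Proof. by move=> e; apply: (iso_monol (i := i)); rewrite fwdK e fwdK. Qed.

Definition iso_sym C (X Y : C) (i : iso X Y) : iso Y X :=
  Iso (fwdK i) (bwdK i).

Definition iso_trans C (X Y Z : C) (i : iso X Y) (j : iso Y Z) : iso X Z.
Proof.
exists (fwd j \o fwd i) (bwd i \o bwd j).
- by rewrite -compA bwdKl bwdK.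
- by rewrite -compA fwdKl fwdK.
Defined.

Definition fmap_iso C D (F : functor C D) (X Y : C) (i : iso X Y) :
  iso (F X) (F Y).
Proof.
exists (fmap F (fwd i)) (fmap F (bwd i)); rewrite -fmap_comp.
- by rewrite bwdK fmap_id.
- by rewrite fwdK fmap_id.
Defined.

(** * Universal arrows from a functor to an object *)

Definition universal C D (F : functor C D) (W : D) (Z : C)
    (u : hom (F Z) W) : Prop :=
  forall (A : C) (f : hom (F A) W), exists! t : hom A Z, u \o fmap F t = f.

Lemma universal_inj C D (F : functor C D) (W : D) (Z : C) (u : hom (F Z) W) :
  universal u -> forall (A : C) (s t : hom A Z),
  u \o fmap F s = u \o fmap F t -> s = t.
Proof.
move=> uP A s t e; have [r [_ U]] := uP A (u \o fmap F t).
by rewrite -(U s e) (U t).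
Qed.

(** Yoneda: naturality determines [phi] by its value at [idm Z]. From here on one universal arrow
    replaces the family of bijections. *)
Lemma represents_universal C D (F : functor C D) (W : D) (Z : C) :
  represents_hom_into F W Z -> exists u : hom (F Z) W, universal u.
Proof.
case=> phi [phi_bij phi_nat]; exists (phi Z (idm Z)) => A f.
have [psi phiK psiK] := phi_bij A.
have E (t : hom A Z) : phi Z (idm Z) \o fmap F t = phi A t.
  by rewrite -phi_nat comp1m.
by exists (psi f); split=> [|t]; rewrite E => // <-.
Qed.

Lemma universal_uniq C D (F : functor C D) (W : D) (Z Z' : C)
    (u : hom (F Z) W) (u' : hom (F Z') W) :
  universal u -> universal u' -> isomorphic Z Z'.
Proof.
move=> uP u'P.
have [s [es _]] := uP _ u'; have [t [et _]] := u'P _ u.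
split; exists t s.
- by apply: (universal_inj uP); rewrite fmap_comp compA es et fmap_id compm1.
- by apply: (universal_inj u'P); rewrite fmap_comp compA et es fmap_id compm1.
Qed.

(* The idempotent [i \o p] on [Y] transports along the representation to an
   idempotent on [Z], whose splitting represents [W]. *)
Lemma universal_retract C D (F : functor C D) (Y W : D) (Z : C)
    (u : hom (F Z) Y) (i : hom W Y) (p : hom Y W) :
  idempotent_complete C -> universal u -> p \o i = idm W ->
  exists (Z' : C) (v : hom (F Z') W), universal v.
Proof.
move=> idemC uP pi.
have [e [eE _]] := uP _ (i \o (p \o u)).
have pueE : p \o (u \o fmap F e) = p \o u.
  by rewrite eE compA pi comp1m.
have ee : e \o e = e.
  by apply: (universal_inj uP); rewrite fmap_comp compA eE -!compA pueE.
have [Z' [r [s [rs sr]]]] := idemC _ _ ee.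
exists Z', (p \o (u \o fmap F s)) => A f.
have [t [tE _]] := uP _ (i \o f).
exists (r \o t); split=> [|t' t'E].
  have -> : p \o (u \o fmap F s) \o fmap F (r \o t)
          = p \o (u \o fmap F e) \o fmap F t.
    by rewrite -sr !fmap_comp !compA.
  by rewrite pueE -compA tE compA pi comp1m.
(* Uniqueness is tested after composing with [s]: the arrow [s \o t'] is fixed by [e], so [u] sends
   it to [i \o f], just as it sends [t]. *)
rewrite -[t']comp1m -rs -compA; congr (_ \o _).
apply: (universal_inj uP); rewrite tE -t'E.
have -> : s \o t' = e \o (s \o t') by rewrite -sr -!compA (precomp _ rs) comp1m.
by rewrite !fmap_comp (precomp _ eE) !compA.
Qed.

(** * Adjoints from universal arrows, and back *)

Lemma right_adjoint_exists C D (F : functor C D) :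
  (forall W : D, exists (Z : C) (u : hom (F Z) W), universal u) ->
  exists R : functor D C, adjoint F R.
Proof.
move=> uP.
(* The hypothesis only asserts existence. Indefinite description chooses the objects [R0 W], the
   counits [u W] and the mediating arrows [T]; the functor laws and naturality then follow from
   uniqueness. *)
have RP W : {Z : C & {u : hom (F Z) W | universal u}}.
  have [Z ZP] := constructive_indefinite_description _ (uP W).
  by exists Z; apply: constructive_indefinite_description.
pose R0 W := projT1 (RP W).
pose u W : hom (F (R0 W)) W := sval (projT2 (RP W)).
have uniP W : universal (u W) by exact: svalP (projT2 (RP W)).
have tP W A (f : hom (F A) W) : {t : hom A (R0 W) | u W \o fmap F t = f}.
  apply: constructive_indefinite_description.
  by have [t [tE _]] := uniP W A f; exists t.
pose T W A (f : hom (F A) W) : hom A (R0 W) := sval (tP W A f).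
have TE W A (f : hom (F A) W) : u W \o fmap F (T W A f) = f.
  exact: svalP (tP W A f).
have T_inj W A s t : u W \o fmap F s = u W \o fmap F t -> s = t :> hom A _.
  exact: (universal_inj (uniP W)).
pose R1 W W' (g : hom W W') : hom (R0 W) (R0 W') := T W' (R0 W) (g \o u W).
have R1_id W : R1 W W (idm W) = idm (R0 W).
  by apply: T_inj; rewrite TE fmap_id comp1m compm1.
have R1_comp X Y Z (g : hom Y Z) (f : hom X Y) :
    R1 X Z (g \o f) = R1 Y Z g \o R1 X Y f.
  by apply: T_inj; rewrite fmap_comp compA !TE -!compA TE.
exists (Functor R1_id R1_comp), (fun X Y => T Y X).
split=> [X Y | X X' Y Y' f g h].
  exists (fun t => u Y \o fmap F t) => f; first exact: TE.
  by apply: T_inj; rewrite TE.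
apply: T_inj; rewrite TE /= !fmap_comp !compA TE.
by rewrite -(compA g (u Y)) TE.
Qed.

Lemma adjoint_universal C D (F : functor C D) (R : functor D C) (W : D) :
  adjoint F R -> exists u : hom (F (R W)) W, universal u.
Proof.
case=> phi [phi_bij phi_nat].
(* The universal arrow is the counit at [W], the preimage of the identity of [R W]. *)
have [psi _ psiK] := phi_bij (R W) W.
have phiE A (t : hom A (R W)) : phi A W (psi (idm _) \o fmap F t) = t.
  have := phi_nat _ _ _ _ t (idm W) (psi (idm _)).
  by rewrite psiK fmap_id !comp1m.
exists (psi (idm _)) => A f; exists (phi A W f).
split=> [|t <-]; last exact: phiE.
by apply: (bij_inj (phi_bij A W)); rewrite phiE.
Qed.

Lemma adjoint_right_universal C D (F : functor C D) (X : C) (W : D)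
    (u : hom (F X) W) (R : functor D C) :
  adjoint F R -> universal u -> isomorphic (R W) X.
Proof.
by move=> /(adjoint_universal W)[v vP] uP; apply: universal_uniq vP uP.
Qed.

(** * Opposite categories, which turn left adjoints into right adjoints *)

Definition opposite C : linearCategory k.
Proof.
unshelve refine (@LinearCategory k (obj C) (fun X Y => hom Y X)
  (fun X => idm X) (fun X Y Z g f => comp f g) _ _ _ _ _).
- by move=> X Y f; apply: compm1.
- by move=> X Y f; apply: comp1m.
- by move=> X Y Z W h g f; rewrite compA.
- by move=> X Y Z f; apply: comp_linearr.
- by move=> X Y Z g; apply: comp_linearl.
Defined.

Definition opposite_iso C (X Y : C) (i : iso X Y) : @iso k (opposite C) X Y :=
  @Iso k (opposite C) X Y (bwd i) (fwd i) (bwdK i) (fwdK i).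

Lemma isomorphic_unopposite C (X Y : C) :
  @isomorphic k (opposite C) X Y -> isomorphic X Y.
Proof. by case=> [[f g gf fg]]; split; exact: (@Iso k C X Y g f gf fg). Qed.

Lemma idempotent_complete_opposite C :
  idempotent_complete C -> idempotent_complete (opposite C).
Proof.
by move=> idemC X e ee; have [Y [r [s [rs sr]]]] := idemC X e ee; exists Y, s, r.
Qed.

Definition opposite_functor C D (F : functor C D) :
  functor (opposite C) (opposite D).
Proof.
unshelve refine (@Functor k (opposite C) (opposite D) (fobj F)
  (fun X Y (f : @hom k C Y X) => fmap F f) _ _).
- exact: (@fmap_id k C D F).
- by move=> X Y Z g f; apply: (@fmap_comp k C D F).
Defined.

Definition unopposite_functor C D (F : functor (opposite C) (opposite D)) :
  functor C D.
Proof.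
unshelve refine (@Functor k C D (fobj F)
  (fun X Y (f : hom X Y) => @fmap k (opposite C) (opposite D) F Y X f) _ _).
- exact: (@fmap_id _ _ _ F).
- by move=> X Y Z g f; apply: (@fmap_comp _ _ _ F).
Defined.

(** Passing to opposites reverses the direction of the bijections, so the witnesses are the inverses
    of [phi], chosen by indefinite description. *)
Lemma adjoint_unopposite C D (F : functor C D)
    (L : functor (opposite D) (opposite C)) :
  adjoint (opposite_functor F) L -> adjoint (unopposite_functor L) F.
Proof.
case=> phi [phi_bij phi_nat].
have psiP X Y : {psi | cancel (phi Y X) psi /\ cancel psi (phi Y X)}.
  apply: constructive_indefinite_description.
  by have [psi ? ?] := phi_bij Y X; exists psi.
exists (fun X Y => sval (psiP X Y)); split=> [X Y | X X' Y Y' f g h].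
  by case: (psiP X Y) => psi [K K'] /=; exists (phi Y X).
case: (psiP X Y) (psiP X' Y') => psi [_ K] [psi' [K' _]] /=.
apply: (canLR K'); have /= := phi_nat Y Y' X X' g f (psi h).
by rewrite K -!compA => ->.
Qed.

End LinearCategories.

(** * Coherence of the tensor product and the reversed monoidal category *)

Section MonoidalCategories.
Variable k : fieldType.
Implicit Types C D : monoidalCategory k.

Lemma tensm_compl C (X X' X'' Y : C) (g : hom X' X'') (f : hom X X') :
  (g \o f) \oxm idm Y = (g \oxm idm Y) \o (f \oxm idm Y).
Proof. by rewrite -tensm_comp comp1m. Qed.

Lemma tensm_compr C (X X' X'' Y : C) (g : hom X' X'') (f : hom X X') :
  idm Y \oxm (g \o f) = (idm Y \oxm g) \o (idm Y \oxm f).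
Proof. by rewrite -tensm_comp comp1m. Qed.

Lemma tensm_swap C (X X' Y Y' : C) (f : hom X X') (g : hom Y Y') :
  (idm X' \oxm g) \o (f \oxm idm Y) = (f \oxm idm Y') \o (idm X \oxm g).
Proof. by rewrite -!tensm_comp !comp1m !compm1. Qed.

Definition tensl_iso C (X Y Z : C) (i : iso Y Z) : iso (X \ox Y) (X \ox Z).
Proof.
exists (idm X \oxm fwd i) (idm X \oxm bwd i); rewrite -tensm_compr.
- by rewrite bwdK tensm_id.
- by rewrite fwdK tensm_id.
Defined.

Definition tensr_iso C (X Y Z : C) (i : iso Y Z) : iso (Y \ox X) (Z \ox X).
Proof.
exists (fwd i \oxm idm X) (bwd i \oxm idm X); rewrite -tensm_compl.
- by rewrite bwdK tensm_id.
- by rewrite fwdK tensm_id.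
Defined.

Lemma assoc_natl C (X X' Y Z : C) (f : hom X X') :
  fwd (assoc X' Y Z) \o ((f \oxm idm Y) \oxm idm Z)
  = (f \oxm idm (Y \ox Z)) \o fwd (assoc X Y Z).
Proof. by rewrite assoc_nat tensm_id. Qed.

Lemma assoc_natm C (X Y Y' Z : C) (f : hom Y Y') :
  fwd (assoc X Y' Z) \o ((idm X \oxm f) \oxm idm Z)
  = (idm X \oxm (f \oxm idm Z)) \o fwd (assoc X Y Z).
Proof. exact: assoc_nat. Qed.

Lemma assoc_natr C (X Y Z Z' : C) (f : hom Z Z') :
  fwd (assoc X Y Z') \o (idm (X \ox Y) \oxm f)
  = (idm X \oxm (idm Y \oxm f)) \o fwd (assoc X Y Z).
Proof. by rewrite -tensm_id assoc_nat. Qed.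

Lemma tens_unit_faithful C (X Y : C) (f g : hom X Y) :
  f \oxm idm tunit = g \oxm idm tunit -> f = g.
Proof.
move=> e; rewrite -[f]compm1 -(fwdK (runit X)) compA -runit_nat e runit_nat.
by rewrite -compA fwdK compm1.
Qed.

(** Kelly's argument: since tensoring with the unit is faithful, the equation may be checked after
    tensoring with [tunit], where the pentagon and two triangles give it. *)
Lemma runit_tens C (X Y : C) :
  (idm X \oxm fwd (runit Y)) \o fwd (assoc X Y tunit) = fwd (runit (X \ox Y)).
Proof.
apply: tens_unit_faithful; apply: (iso_monol (i := assoc X Y tunit)).
rewrite tensm_compl (precomp _ (assoc_natm _ _ _)) -triangle tensm_compr.
rewrite -!compA (compA (idm X \oxm fwd (assoc Y _ _))) -pentagon.
rewrite (precomp _ (esym (assoc_natr _ _ _))) -compA.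
by rewrite triangle.
Qed.

Definition reverse C : monoidalCategory k.
Proof.
unshelve refine (@MonoidalCategory k (mcat C) (fun X Y => Y \ox X)
  (fun X X' Y Y' f g => g \oxm f) tunit _ _ _ _
  (fun X Y Z => iso_sym (assoc Z Y X)) (@runit k C) (@lunit k C) _ _ _ _ _).
- by move=> X Y; apply: tensm_id.
- by move=> *; apply: tensm_comp.
- by move=> *; apply: tensm_linearr.
- by move=> *; apply: tensm_linearl.
- move=> X X' Y Y' Z Z' f g h /=; apply: iso_square; exact: assoc_nat.
- by move=> *; apply: runit_nat.
- by move=> *; apply: lunit_nat.
(* The reversed pentagon is the inverse of the original one: both sides are inverses of composite
   isomorphisms whose forward maps agree. *)
- move=> X Y Z W /=.
  have := @bwd_unique _ _ _ _
    (iso_trans (assoc (W \ox Z) Y X) (assoc W Z (Y \ox X)))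
    (iso_trans (tensr_iso X (assoc W Z Y))
       (iso_trans (assoc W (Z \ox Y) X) (tensl_iso W (assoc Z Y X)))).
  by rewrite /= -!compA; apply; rewrite pentagon compA.
- move=> X Y /=.
  by rewrite -triangle -compA fwdK compm1.
Defined.

(** * Dual pairs and the transposition bijection *)

Definition coev_zigzag C (X Y : C) (c : hom tunit (X \ox Y))
    (e : hom (Y \ox X) tunit) : Prop :=
  fwd (runit X) \o (idm X \oxm e) \o fwd (assoc X Y X) \o (c \oxm idm X)
    \o bwd (lunit X) = idm X.

(** The second zigzag is by conversion the first one in [reverse C], so a lemma about one zigzag
    covers both. *)
Lemma is_left_dualE C (X Y : C) :
  is_left_dual X Y <->
  exists (c : hom tunit (X \ox Y)) (e : hom (Y \ox X) tunit),
    @coev_zigzag C X Y c e /\ @coev_zigzag (reverse C) Y X c e.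
Proof. by []. Qed.

Lemma is_left_dual_reverse C (X Y : C) :
  is_left_dual X Y -> @is_left_dual k (reverse C) Y X.
Proof. by case=> c [e [z1 z2]]; exists c, e. Qed.

Section Transpose.
Variables (C : monoidalCategory k) (X Y : C).
Variables (c : hom tunit (X \ox Y)) (e : hom (Y \ox X) tunit).

Definition transpose (A B : C) (f : hom (A \ox X) B) : hom A (B \ox Y) :=
  (f \oxm idm Y) \o bwd (assoc A X Y) \o (idm A \oxm c) \o bwd (runit A).

Definition untranspose (A B : C) (g : hom A (B \ox Y)) : hom (A \ox X) B :=
  fwd (runit B) \o (idm B \oxm e) \o fwd (assoc B Y X) \o (g \oxm idm X).

(** Naturality slides [f] to the left end of the composite; by the pentagon and [runit_tens], what
    remains is the zigzag tensored with [A]. *)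
Lemma transposeK A B :
  @coev_zigzag C X Y c e -> cancel (@transpose A B) (@untranspose A B).
Proof.
move=> zz f; rewrite /untranspose /transpose !tensm_compl -!compA.
rewrite (precomp _ (assoc_natl _ _ _)) -compA (precomp _ (tensm_swap _ _)).
rewrite -compA (precomp _ (runit_nat _)) -compA -[RHS]compm1; congr (_ \o _).
have pent := iso_square (i := tensr_iso X (assoc A X Y))
  (pentagon A X Y X).
rewrite /= in pent.
rewrite (precomp _ (esym pent)) -!compA.
rewrite (precomp _ (esym (iso_square (assoc_natr _ _ _)))) -runit_tens -!compA.
rewrite fwdKl (precomp _ (assoc_natm _ _ _)) -compA.
have -> : fwd (assoc A tunit X) \o (bwd (runit A) \oxm idm X)
        = idm A \oxm bwd (lunit X).
  apply: (iso_monol (i := tensl_iso A (lunit X))) => /=.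
  by rewrite compA triangle -tensm_compl -tensm_compr !fwdK !tensm_id.
by rewrite -!tensm_compr !compA zz tensm_id.
Qed.

Lemma untransposeK A B :
  @coev_zigzag (reverse C) Y X c e ->
  cancel (@untranspose A B) (@transpose A B).
Proof.
rewrite /coev_zigzag /= => zz g.
rewrite /untranspose /transpose !tensm_compl -!compA.
rewrite (precomp _ (esym (iso_square (assoc_natl _ _ _)))) -compA.
rewrite (precomp _ (esym (tensm_swap _ _))) -compA.
rewrite (esym (iso_square (runit_nat _))) !compA -[RHS]comp1m.
congr (_ \o _); rewrite -!compA.
have pent := iso_square (i := assoc (B \ox Y) X Y)
  (i' := iso_trans (assoc B (Y \ox X) Y) (tensl_iso B (assoc Y X Y)))
  (esym (pentagon B Y X Y)).
rewrite /= in pent.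
rewrite (precomp _ (esym pent)) -!compA.
rewrite (precomp _ (esym (iso_square (assoc_natm _ _ _)))) -compA.
rewrite (precomp _ (assoc_natr _ _ _)) -compA.
have -> : fwd (assoc B Y tunit) \o bwd (runit (B \ox Y))
        = idm B \oxm bwd (runit Y).
  apply: (iso_monol (i := tensl_iso B (runit Y))) => /=.
  by rewrite compA runit_tens -tensm_compr !fwdK tensm_id.
rewrite -triangle -!compA fwdKl.
by rewrite -!tensm_compr !compA zz tensm_id.
Qed.

Lemma transpose_bijective A B :
  @coev_zigzag C X Y c e -> @coev_zigzag (reverse C) Y X c e ->
  bijective (@transpose A B).
Proof.
move=> z1 z2; exists (@untranspose A B); first exact: transposeK.
exact: untransposeK.
Qed.

End Transpose.

(** * Strong monoidal functors, duals and transposes *)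

Lemma mu_assoc_bwd C D (F : functor C D) (M : monoidalStructure F) (X Y Z : C) :
  fmap F (bwd (assoc X Y Z)) \o fwd (mu M X (Y \ox Z))
    \o (idm (F X) \oxm fwd (mu M Y Z))
  = fwd (mu M (X \ox Y) Z) \o (fwd (mu M X Y) \oxm idm (F Z))
    \o bwd (assoc (F X) (F Y) (F Z)).
Proof.
rewrite -compA; apply: (iso_square (i' := fmap_iso F (assoc X Y Z))) => /=.
by rewrite compA mu_assoc.
Qed.

(** The associators of [reverse] are the inverse associators, so its associativity axiom is
    [mu_assoc_bwd], and the two unit axioms trade places. *)
Definition reverse_monoidal C D (F : functor C D) (M : monoidalStructure F) :
  @monoidalStructure k (reverse C) (reverse D) F.
Proof.
unshelve refine (@MonoidalStructure k (reverse C) (reverse D) F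
  (fun X Y => mu M Y X) (eta M) _ _ _ _).
- by move=> X X' Y Y' f g; apply: (mu_nat M).
- by move=> X Y Z; exact: (mu_assoc_bwd M Z Y X).
- by move=> X; apply: (mu_runit M).
- by move=> X; apply: (mu_lunit M).
Defined.

Section StrongMonoidalFunctor.
Variables (C D : monoidalCategory k) (F : functor C D).
Variable M : monoidalStructure F.

Definition fmap_coev (X Y : C) (c : hom tunit (X \ox Y)) :
    hom tunit (F X \ox F Y) :=
  bwd (mu M X Y) \o fmap F c \o fwd (eta M).

Definition fmap_ev (X Y : C) (e : hom (Y \ox X) tunit) :
    hom (F Y \ox F X) tunit :=
  bwd (eta M) \o fmap F e \o fwd (mu M Y X).

Lemma mu_natl (X X' Y : C) (f : hom X X') :
  fwd (mu M X' Y) \o (fmap F f \oxm idm (F Y))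
  = fmap F (f \oxm idm Y) \o fwd (mu M X Y).
Proof. by rewrite -fmap_id mu_nat. Qed.

Lemma mu_natr (X Y Y' : C) (f : hom Y Y') :
  fwd (mu M X Y') \o (idm (F X) \oxm fmap F f)
  = fmap F (idm X \oxm f) \o fwd (mu M X Y).
Proof. by rewrite -fmap_id mu_nat. Qed.

(** The structure maps [mu] and [eta] cancel against their inverses, leaving the image under [F] of
    the zigzag in [C]. *)
Lemma fmap_coev_zigzag (X Y : C) (c : hom tunit (X \ox Y))
    (e : hom (Y \ox X) tunit) :
  coev_zigzag c e -> coev_zigzag (fmap_coev c) (fmap_ev e).
Proof.
move=> zz; rewrite /coev_zigzag /fmap_coev /fmap_ev.
rewrite -(mu_runit M) !tensm_compr !tensm_compl -!compA.
rewrite [idm _ \oxm fwd (eta M) \o _](fwdKl (tensl_iso (F X) (eta M))).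
rewrite (precomp _ (mu_natr _ _)) -compA.
have ma := esym (mu_assoc M X Y X); rewrite -!compA in ma.
rewrite (compA (idm (F X) \oxm _)) (precomp _ ma) -!compA.
rewrite [_ \oxm _ \o (bwd _ \oxm _ \o _)]
  (fwdKl (tensr_iso (F X) (mu M X Y))).
rewrite (precomp _ (mu_natl _ _)) -compA.
have -> : fwd (mu M tunit X) \o ((fwd (eta M) \oxm idm (F X))
            \o bwd (lunit (F X))) = fmap F (bwd (lunit X)).
  apply: (iso_monol (i := fmap_iso F (lunit X))) => /=.
  by rewrite !compA mu_lunit fwdK -fmap_comp fwdK fmap_id.
by rewrite -!fmap_comp !compA zz fmap_id.
Qed.

(** Up to [mu], transposing commutes with [F]. This links the transposition bijections of [C] and
    [D] in [tens_counit_universal]. *)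
Lemma fmap_transpose (A V X B : C) (c : hom tunit (V \ox X))
    (t : hom (A \ox V) B) :
  bwd (mu M B X) \o fmap F (transpose c t)
  = transpose (fmap_coev c) (fmap F t \o fwd (mu M A V)).
Proof.
rewrite /transpose !fmap_comp -!compA.
rewrite (precomp _ (iso_square (mu_natl X t))) tensm_compl -!compA.
congr (_ \o _); apply: (iso_monol (i := mu M (A \ox V) X)); rewrite fwdKl.
have ma := mu_assoc_bwd M A V X; rewrite -!compA in ma.
rewrite (compA (_ \oxm _) (bwd (assoc _ _ _))) (precomp _ (esym ma)) -!compA.
congr (_ \o _); rewrite /fmap_coev !tensm_compr -!compA.
rewrite [_ \oxm _ \o (_ \oxm bwd _ \o _)](fwdKl (tensl_iso (F A) (mu M V X))).
rewrite (precomp _ (mu_natr _ _)) -compA; congr (_ \o _).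
apply: (iso_monol (i := fmap_iso F (runit A))) => /=.
by rewrite !compA mu_runit fwdK -fmap_comp fwdK fmap_id.
Qed.

End StrongMonoidalFunctor.

(** * Arrows into and out of [F X], given a representation at the unit *)

Section RepresentingUnit.
Variables (C D : monoidalCategory k) (F : functor C D).
Variable M : monoidalStructure F.
Variables (Z : C) (u : hom (F Z) tunit).
Hypothesis uP : universal u.

Definition tens_counit (X : C) : hom (F (Z \ox X)) (F X) :=
  fwd (lunit (F X)) \o (u \oxm idm (F X)) \o bwd (mu M Z X).

Lemma tens_counit_nat (X Y : C) (f : hom X Y) :
  tens_counit Y \o fmap F (idm Z \oxm f) = fmap F f \o tens_counit X.
Proof.
rewrite /tens_counit -!compA (iso_square (mu_natr M Z f)).
rewrite (precomp _ (esym (tensm_swap _ _))) -compA.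
by rewrite (precomp _ (lunit_nat _)) -!compA.
Qed.

Lemma tens_counit_universal (V X : C) :
  is_left_dual V X -> universal (tens_counit X).
Proof.
case/is_left_dualE=> c [e [z1 z2]].
have z1F := fmap_coev_zigzag M z1.
(* The second zigzag for [F V] and [F X] is the first one for the reversed functor. *)
have z2F := fmap_coev_zigzag (reverse_monoidal M) z2.
have trE A (t : hom (A \ox V) Z) : tens_counit X \o fmap F (transpose c t)
    = fwd (lunit (F X))
      \o transpose (fmap_coev M c) (u \o (fmap F t \o fwd (mu M A V))).
  rewrite /tens_counit -!compA fmap_transpose; congr (_ \o _).
  by rewrite /transpose !tensm_compl !compA.
move=> A f.
have [tr trK KtrC] := transpose_bijective A Z z1 z2.
have [trD trDK KtrD] :=
  @transpose_bijective D _ _ _ _ (F A) tunit z1F z2F.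
(* Untransposing [f] in [D] gives an arrow from [F A \ox F V] to the unit; universality of [u] lifts
   it to [t], which is transposed back in [C]. *)
have [t [tE _]] := uP (trD (bwd (lunit (F X)) \o f) \o bwd (mu M A V)).
exists (transpose c t); split=> [|h hE].
  by rewrite trE compA tE -compA bwdK compm1 KtrD fwdKl.
rewrite -[h]KtrC; congr transpose; apply: (universal_inj uP); rewrite tE.
by rewrite -hE -[h in LHS]KtrC trE bwdKl trDK -!compA fwdK compm1.
Qed.

(** Arrows from [Zl \ox X] to [A] correspond to arrows from [X] to [Z \ox A], hence to arrows from
    [F X] to [F A]. The opposite categories put this in the form required by
    [right_adjoint_exists]. *)
Lemma tens_dual_universal (X Zl : C) :
  (forall A : C, exists dA : C, is_right_dual A dA) -> is_left_dual Z Zl ->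
  exists w : @hom k (opposite D) (F (Zl \ox X)) (F X),
    universal (F := opposite_functor F) (W := F X) (Z := Zl \ox X) w.
Proof.
move=> dualC /is_left_dualE[c [e [z1 z2]]].
(* Transposition in [reverse C] acts on left tensor factors: it is the adjunction of [Zl \ox -] and
   [Z \ox -]. *)
have tbij A := @transpose_bijective (reverse C) Zl Z c e X A z2 z1.
(* The unit of this adjunction at [X], mapped by [F] and followed by the counit. *)
exists (tens_counit (Zl \ox X) \o
   fmap F (fwd (assoc Z Zl X) \o (c \oxm idm X) \o bwd (lunit X))) => A f.
have {dualC}[dA /tens_counit_universal tP] := dualC A.
have tE (t : @hom k C (Zl \ox X) A) :
    fmap F t \o (tens_counit (Zl \ox X) \o
      fmap F (fwd (assoc Z Zl X) \o (c \oxm idm X) \o bwd (lunit X)))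
    = tens_counit A \o fmap F (@transpose (reverse C) Zl Z c X A t).
  by rewrite compA -tens_counit_nat -compA -fmap_comp /transpose /= -!compA.
have [s [sE sU]] := tP X f; have [tr trK Ktr] := tbij A.
exists (tr s); split=> [|t tsE]; first by rewrite /= tE Ktr.
by rewrite (sU (@transpose (reverse C) Zl Z c X A t)) ?trK // -tE.
Qed.

Lemma left_adjoint_tunit (L : functor (opposite D) (opposite C)) (Zl : C) :
  (forall A : C, exists dA : C, is_right_dual A dA) -> is_left_dual Z Zl ->
  adjoint (opposite_functor F) L -> @isomorphic k C (L tunit) Zl.
Proof.
move=> dualC ZlP adjL.
have [w wP] := tens_dual_universal tunit dualC ZlP.
have [i] := adjoint_right_universal adjL wP.
(* The corepresentation computes [L (F tunit)]; [eta] carries it over to [L tunit]. *)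
have [j] : @isomorphic k C (L tunit) (Zl \ox tunit).
  apply: isomorphic_unopposite.
  by split; apply: (iso_trans (fmap_iso L (opposite_iso (eta M))) i).
by split; apply: (iso_trans j (runit Zl)).
Qed.

End RepresentingUnit.

End MonoidalCategories.

(** * The two adjoints and their values at the unit *)

Theorem corollary5p5 (k : fieldType) (C D : monoidalCategory k)
    (addC : additive_category C) (addD : additive_category D)
    (rigidC : rigid C) (rigidD : rigid D)
    (F : functor C D) (linF : linear_functor F) (monF : monoidalStructure F)
    (Z : C) (reprZ : represents_hom_into F tunit Z)
    (domF : dominant F)
    (idemC : idempotent_complete C) :
  exists L R : functor D C,
    [/\ adjoint L F, adjoint F R,
        isomorphic (R tunit) Z
      & forall Zl Zr : C, is_left_dual Z Zl -> is_right_dual Z Zr ->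
          isomorphic (L tunit) Zl /\ isomorphic Zl Zr].
Proof.
have [u uP] := represents_universal reprZ.
have rdual A : exists dA : C, is_right_dual A dA by case: (rigidC A).
have [R adjR] : exists R : functor D C, adjoint F R.
  apply: right_adjoint_exists => W.
  have [X [W' [i [_ [p [_ [pi _ _ _ _]]]]]]] := domF W.
  (* [X] is a left dual of its right dual [V], so [Z \ox X] represents arrows into [F X]; [W] is a
     retract of [F X]. *)
  have [V VX] := rdual X.
  exact: (universal_retract idemC (tens_counit_universal monF uP VX) pi).
have [L adjL] : exists L : functor (opposite D) (opposite C),
    adjoint (opposite_functor F) L.
  apply: right_adjoint_exists => W.
  have [X [W' [i [_ [p [_ [pi _ _ _ _]]]]]]] := domF W.
  have [[Zl ZlP] _] := rigidC Z.
  have [w wP] := tens_dual_universal monF uP X rdual ZlP.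
  (* In the opposite category the inclusion and the projection exchange roles. *)
  exact: (universal_retract (i := p : @hom k (opposite D) W (F X))
    (idempotent_complete_opposite idemC) wP pi).
exists (unopposite_functor L), R; split=> //.
- exact: adjoint_unopposite.
- exact: adjoint_right_universal adjR uP.
move=> Zl Zr ZlP ZrP.
have LZl := left_adjoint_tunit monF uP rdual ZlP adjL.
have rdual' (A : reverse C) : exists dA : reverse C, is_right_dual A dA.
  have [[Ad AdP] _] := rigidC A.
  by exists Ad; apply: is_left_dual_reverse AdP.
(* Reversal turns the right dual [Zr] of [Z] into a left dual, while [L] and [u] stay the same. *)
have LZr := left_adjoint_tunit (reverse_monoidal monF) uP rdual'
  (is_left_dual_reverse ZrP) adjL.
split=> //; case: LZl LZr => i [j]; split.
exact: iso_trans (iso_sym i) j.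
Qed.
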